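(* Let $U \subseteq \mathbb{R}^n$ be a convex domain and let $F = (f^1,\dots,f^n) : U \to \mathbb{R}^n$ be a Lipschitz mapping. Let $$\mathcal{J} = \{ J : J \in \partial F(u) \text{ for some } u \in U \}$$ be the set of all $n\times n$ matrices belonging to the generalized (Clarke) Jacobians of $F$ at points of $U$. If $\mathcal{J}$ is a strict $V$-family, then $F$ is globally invertible on $U$.
   Context: Notation: $\|\cdot\|$ is the Euclidean norm on $\mathbb{R}^n$ and $ax$ denotes the Euclidean inner product of $a, x \in \mathbb{R}^n$. Convex domain: a convex set $U \subseteq \mathbb{R}^n$ with nonempty interior (for example an open convex set, a cube or a simplex). Generalized (Clarke) Jacobian: for a Lipschitz mapping $F : U \to \mathbb{R}^n$ and $x \in U$, $\partial F(x)$ is the convex hull of all $n\times n$ matrices $M$ such that $M = \lim_{i\to\infty} JF(x_i)$ for some sequence of points $x_i \to x$ in the interior of $U$ at which $F$ is differentiable, where $JF(x_i)$ is the usual Jacobian matrix of $F$ at $x_i$. (Lipschitz mappings are differentiable almost everywhere.) Cones: a cone is a set $K \subseteq \mathbb{R}^n$ such that $\lambda x \in K$ for all $x \in K$ and $\lambda \ge 0$. For $A \subseteq \mathbb{R}^n$, $\mathrm{cone\,hull}(A)$ is the union of all rays from the origin that intersect $A$; for $A$ not containing the origin this is $\{\lambda a : a \in A,\ \lambda \ge 0\}$. A cone is acute if no nonempty finite collection of its nonzero elements sums to zero (for a convex cone, equivalently, it contains no nontrivial linear subspace). Sums and differences of cones are in the Minkowski sense: $K_1 \pm K_2 \pm \dots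 \pm K_n = \{x_1 \pm x_2 \pm \dots \pm x_n : x_i \in K_i\}$ for a given choice of signs; there are $2^{n-1}$ such cones, one for each independent choice of the $n-1$ signs. $V$-family: let $\mathcal{M}$ be a family of real $n \times n$ matrices, and let $R_i \subseteq \mathbb{R}^n$ be the set of all $i$-th columns of matrices in $\mathcal{M}$, $i = 1,\dots,n$. Put $K_i = \mathrm{cone\,hull}(R_i)$. The family $\mathcal{M}$ is a $V$-family if (1) for some $\delta > 0$, $R_i \cap \{x \in \mathbb{R}^n : \|x\| \le \delta\} = \emptyset$ for all $i = 1,\dots,n$; and (2) each of the $2^{n-1}$ cones $K_1 \pm K_2 \pm \dots \pm K_n$ is acute. Strict $V$-family: a $V$-family such that, additionally, each of the $2^{n-1}$ cones $K_1 \pm K_2 \pm \dots \pm K_n$ is contained in a cone of the form $\{x \in \mathbb{R}^n : ax \ge \varepsilon \|x\|\}$ for some vector $a \in \mathbb{R}^n$ (a certificate vector) and some $\varepsilon > 0$, where $a$ and $\varepsilon$ may depend on the choice of signs. Globally invertible on $U$: $F$ is injective on $U$, i.e. $F$ has an inverse $F^{-1} : F(U) \to U$. *)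

(* Defs.v *)
(* R^n is the space 'rV[R]_n of row vectors.  Its library norm is the sup norm:
   it provides the topology and differentiability, while every metric
   condition below uses the Euclidean norm [enorm]. *)
From HB Require Import structures.
From mathcomp Require Import all_boot all_order all_algebra.
From mathcomp Require Import all_classical all_reals all_analysis.

Set Implicit Arguments.
Unset Strict Implicit.
Unset Printing Implicit Defensive.

Import Order.TTheory GRing.Theory Num.Theory.
Import numFieldNormedType.Exports.

Local Open Scope classical_set_scope.
Local Open Scope ring_scope.

Section Euclidean.
Context {R : realType} {n : nat}.

Definition dot (a x : 'rV[R]_n) : R := \sum_(i < n) a 0 i * x 0 i.

Definition enorm (x : 'rV[R]_n) : R := Num.sqrt (\sum_(i < n) x 0 i ^+ 2).

Definition convex_domain (U : set 'rV[R]_n) : Prop :=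
  @convex_set R 'rV[R]_n U /\ U° !=set0.

Definition lipschitz_map (U : set 'rV[R]_n) (F : 'rV[R]_n -> 'rV[R]_n) : Prop :=
  exists L : R, forall x y, U x -> U y ->
    enorm (F x - F y) <= L * enorm (x - y).

(* The library's ['J F x] acts on row vectors from the right, so its (j, i)
   entry is the partial derivative of f^i in x_j; the usual Jacobian matrix is
   its transpose. *)
Definition usual_jacobian (F : 'rV[R]_n -> 'rV[R]_n) (x : 'rV[R]_n) : 'M[R]_n :=
  ('J F x)^T.

Definition convex_hull (A : set 'M[R]_n) : set 'M[R]_n :=
  smallest (@convex_set R 'M[R]_n) A.

(* The map is represented by a total function; only interior points of [U]
   are used, so its values outside [U] are irrelevant here. *)
Definition clarke_jacobian (U : set 'rV[R]_n) (F : 'rV[R]_n -> 'rV[R]_n)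
    (u : 'rV[R]_n) : set 'M[R]_n :=
  convex_hull [set M | exists x : nat -> 'rV[R]_n,
    [/\ forall k, U° (x k) /\ differentiable F (x k),
        x k @[k --> \oo] --> u &
        usual_jacobian F (x k) @[k --> \oo] --> M]].

Definition ray (v : 'rV[R]_n) : set 'rV[R]_n :=
  [set x | exists2 t : R, 0 <= t & x = t *: v].

Definition cone_hull (A : set 'rV[R]_n) : set 'rV[R]_n :=
  \bigcup_(v in [set v | v != 0 /\ ray v `&` A !=set0]) ray v.

(* Finite collections are sequences, repetitions allowed. *)
Definition acute (K : set 'rV[R]_n) : Prop :=
  forall s : seq 'rV[R]_n, s != [::] ->
    (forall x, x \in s -> K x /\ x != 0) -> \sum_(x <- s) x != 0.

Definition column_set (MM : set 'M[R]_n) (i : 'I_n) : set 'rV[R]_n :=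
  [set (col i M)^T | M in MM].

Definition column_cone (MM : set 'M[R]_n) (i : 'I_n) : set 'rV[R]_n :=
  cone_hull (column_set MM i).

(* [s i = true] stands for a minus sign in front of the i-th cone; the first
   cone always carries a plus sign, which leaves 2^(n-1) choices. *)
Definition sign_choice (s : {ffun 'I_n -> bool}) : Prop :=
  forall i : 'I_n, i = 0%N :> nat -> s i = false.

Definition signed_sum (K : 'I_n -> set 'rV[R]_n) (s : {ffun 'I_n -> bool}) :
    set 'rV[R]_n :=
  [set y | exists2 x : 'I_n -> 'rV[R]_n, forall i, K i (x i) &
    y = \sum_(i < n) (-1) ^+ s i *: x i].

Definition V_family (MM : set 'M[R]_n) : Prop :=
  (exists2 delta : R, 0 < delta &
     forall i, column_set MM i `&` [set x | enorm x <= delta] = set0) /\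
  (forall s, sign_choice s -> acute (signed_sum (column_cone MM) s)).

Definition strict_V_family (MM : set 'M[R]_n) : Prop :=
  V_family MM /\
  (forall s, sign_choice s -> exists (a : 'rV[R]_n) (eps : R), 0 < eps /\
     signed_sum (column_cone MM) s `<=` [set x | dot a x >= eps * enorm x]).

End Euclidean.

(* Main.v *)
(* Let [x <> y] be points of [U] and [d = y - x]. The signs of [d] select one
   of the cones, whose certificate [a] satisfies [a (J d) >= c] for a constant
   [c > 0] and every Jacobian matrix [J] of [F]; so [a F] grows at rate at least
   [c] along [d] at each point of differentiability, and it remains to
   integrate. This requires that almost every line parallel to [d] meets the set
   of non-differentiability in a null set, i.e. Rademacher and Fubini.

   In dimension one, a Lipschitz function is an indefinite integral, by
   Radon-Nikodym applied to a Stieltjes measure. In dimension [n],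
   differentiability is obtained one coordinate at a time: if [f] is well
   approximated by the linear form [a] in the directions of the first [k]
   coordinates at all points of a set [A], and along the axis [e_k] at [x], then
   it is so in the first [k+1] coordinates at [x], as soon as [x] is a density
   point of [A] on the line through [x] parallel to [e_k]. The exceptional set
   is thus a countable union of Borel sets, each null on all lines parallel to
   one of the axes, and no measure on R^n is needed beyond products of uniform
   probabilities. *)
Require Import Defs.
From HB Require Import structures.
From mathcomp Require Import all_boot all_order all_algebra.
From mathcomp Require Import all_classical all_reals all_analysis.
From mathcomp Require Import measurable_realfun ring lra.

Set Implicit Arguments.
Unset Strict Implicit.
Unset Printing Implicit Defensive.

Import Order.TTheory GRing.Theory Num.Theory.
Import numFieldNormedType.Exports.

Local Open Scope classical_set_scope.
Local Open Scope ring_scope.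

(** * Lipschitz functions of one real variable *)

Section stieltjes.
Context {R : realType}.
Implicit Types (f : cumulative R R) (L : R).
Local Open Scope ereal_scope.

(** Both measures are infima over countable covers by half-open intervals, and on each such interval
    the length given by [f] is at most [L] times the usual one. *)
Lemma le_lebesgue_stieltjes_measure f L : (0 < L)%R ->
  (forall x y, x <= y -> f y - f x <= L * (y - x))%R ->
  forall A, lebesgue_stieltjes_measure f A <= L%:E * lebesgue_measure A.
Proof.
move=> L0 fL A.
rewrite -lee_pdivrMl//.
rewrite /lebesgue_measure/lebesgue_stieltjes_measure/measure_extension.
apply: le_ereal_inf_tmp => _ [B cB <-].
rewrite lee_pdivrMl// -nneseriesZl//.
apply: (@le_trans _ _ (\sum_(k <oo) wlength f (B k))).
  by apply: ereal_inf_lbound; exists B.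
apply: lee_nneseries => k _ //.
have /ocitvP[->|[[x y]/= xy ->]] := cB.1 k.
  by rewrite [leLHS]wlength0 mule_ge0 ?lee_fin ?(ltW L0)// wlength_ge0.
rewrite [leLHS]wlength_itv_bnd ?(ltW xy)//.
rewrite [X in _ * X]wlength_itv_bnd ?(ltW xy)//.
rewrite -EFinM lee_fin.
exact/fL/ltW.
Qed.

End stieltjes.

(** * Derivatives as first-order expansions *)

Section slope.
Context {R : realType}.
Implicit Types (h : R -> R).

(** The derivative without a quotient, so that the increment [s = 0] is no special case. *)
Definition slope_at h (t b : R) := forall e, 0 < e ->
  exists2 d, 0 < d &
    forall s, `|s| < d -> `|h (t + s) - h t - s * b| <= e * `|s|.

Lemma is_derive_slope_at h t b : is_derive t (1 : R) h b <-> slope_at h t b.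
Proof.
have E s : s != 0 ->
    `|b - s^-1 *: (h (s *: 1 + t) - h t)| = `|h (t + s) - h t - s * b| / `|s|.
  move=> s0; rewrite -normfV -normrM distrC [s *: 1]mulr1 [s + t]addrC.
  by congr `|_|; rewrite /GRing.scale/=; field.
split=> [[hd hb] e e0|hb].
- have /cvgrPdist_le /(_ _ e0) [d /= d0 hdb] :
      s^-1 *: (h (s *: 1 + t) - h t) @[s --> 0^'] --> b by rewrite -hb.
  exists d => // s sd; have [->|s0] := eqVneq s 0.
    by rewrite addr0 subrr mul0r subr0 !normr0 mulr0.
  rewrite -ler_pdivrMr ?normr_gt0// -E//; apply: hdb => //=.
  by rewrite sub0r normrN.
- have cv : s^-1 *: (h (s *: 1 + t) - h t) @[s --> 0^'] --> b.
    apply/cvgrPdist_le => e e0; have [d d0 hd] := hb _ e0.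
    exists d => // s; rewrite /= sub0r normrN => sd s0.
    by rewrite E// ler_pdivrMr ?normr_gt0//; exact: hd.
  by apply: DeriveDef; [apply/cvg_ex; exists b|exact/cvg_lim].
Qed.

End slope.

Lemma lipschitz_continuous {R : realType} {V W : normedModType R} (f : V -> W)
    (L : R) : 0 < L -> (forall x y, `|f x - f y| <= L * `|x - y|) ->
  continuous f.
Proof.
move=> L0 fL x; apply/cvgrPdist_le => e e0; near=> y.
rewrite (le_trans (fL _ _))// -ler_pdivlMl//.
by near: y; apply: cvgr_dist_le => //; rewrite mulr_gt0 ?invr_gt0.
Unshelve. all: by end_near. Qed.

Section lipschitz_real.
Context {R : realType}.
Variables (h : R -> R) (L : R).
Hypothesis L0 : 0 < L.
Hypothesis hL : forall x y, `|h x - h y| <= L * `|x - y|.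
Notation mu := (@lebesgue_measure R).

(** The added slope [L] makes [h] nondecreasing, so that it generates a Stieltjes measure. *)
Let H x := h x + L * x.

Let H_incr : nondecreasing H.
Proof.
move=> x y xy; rewrite /H -subr_ge0.
have := hL x y; rewrite [`|x - y|]distrC (@ger0_norm _ (y - x)) ?subr_ge0//.
by have := ler_norm (h x - h y); lra.
Qed.

Let H_rc : right_continuous H.
Proof.
apply: right_continuousW => x; apply: cvgD.
  exact: (@lipschitz_continuous R R R h L L0 hL).
by apply: cvgM; [exact: cvg_cst|exact: cvg_id].
Qed.

(** Here [g] is the Radon-Nikodym density of the Stieltjes measure of [H]. Integrating it recovers
    the increments of [H], and at almost every point the integral has derivative [g], so that [h]
    has derivative [g - L]. *)
Lemma lipschitz_FTC a b : a < b -> exists g : R -> R,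
  [/\ forall x, 0 <= g x, mu.-integrable setT (EFin \o g),
      forall x, a <= x <= b ->
        h x - h a + L * (x - a) = \int[mu]_(t in `]a, x]) g t &
      {ae mu, forall x, a < x < b -> is_derive x 1 h (g x - L)}].
Proof.
move=> ab.
pose Hc : cumulative R R := HB.pack H (isCumulative.Build R _ R H H_incr H_rc).
pose nu := lebesgue_stieltjes_measure Hc.
(* Both summands of [H] are [L]-Lipschitz, whence the factor 2. *)
have nu_mu A : (nu A <= (2 * L)%:E * mu A)%E.
  apply: le_lebesgue_stieltjes_measure; first by rewrite mulr_gt0.
  move=> x y xy; rewrite [Hc y]/(H y) [Hc x]/(H x) /H.
  have := hL y x; rewrite (@ger0_norm _ (y - x)) ?subr_ge0//.
  by have := ler_norm (h y - h x); lra.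
have nuE x y : x <= y -> nu `]x, y]%classic = (H y - H x)%:E.
  move=> xy; rewrite /nu /lebesgue_stieltjes_measure/measure_extension.
  by rewrite measurable_mu_extE; [exact: (wlength_itv_bnd Hc)|exact: is_ocitv].
have mab : measurable (`]a, b]%classic : set (measurableTypeR R)).
  exact: measurable_itv.
have nuoo : (nu `]a, b]%classic < +oo)%E by rewrite nuE ?ltW// ltry.
(* Restricting to the interval gives a finite measure, to which Radon-Nikodym applies. *)
pose nur := mfrestr mab nuoo.
have dom : nur `<< mu.
  apply/null_content_dominatesP => A mA A0.
  apply/eqP; rewrite eq_le measure_ge0 andbT.
  rewrite /nur /mfrestr /mrestr (le_trans (nu_mu _))//.
  rewrite (_ : mu (A `&` _) = 0)%E ?mule0//.
  apply/eqP; rewrite eq_le measure_ge0 andbT -A0.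
  by apply: le_measure; rewrite ?inE//; exact: measurableI.
have [g [g0 gfin gint nug]] := radon_nikodym_sigma_finite dom.
have gE : EFin \o (fine \o g) = g.
  by apply/funext => x /=; rewrite fineK.
have gint' : mu.-integrable setT (EFin \o (fine \o g)) by rewrite gE.
have FE x : a <= x <= b ->
    h x - h a + L * (x - a) = \int[mu]_(t in `]a, x]) (fine \o g) t.
  move=> /andP[ax xb].
  have nurE : nur `]a, x]%classic = (H x - H a)%:E.
    rewrite -nuE//; congr (nu _); apply: setIidl.
    by apply: subset_itvl; rewrite bnd_simp.
  have E : nur `]a, x]%classic = (\int[mu]_(t in `]a, x]) g t)%E.
    by apply: nug; exact: measurable_itv.
  rewrite -[LHS]/(fine (_%:E)).
  rewrite (_ : (h x - h a + L * (x - a)) = H x - H a); last by rewrite /H; ring.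
  rewrite -nurE E; congr fine; apply: eq_integral => y _.
  by rewrite /= fineK.
exists (fine \o g); split=> //; first by move=> x; exact: fine_ge0.
have gintI y : mu.-integrable [set` Interval (BRight a) (BRight y)]
    (EFin \o (fine \o g)).
  by apply: integrableS gint'.
have locg : locally_integrable [set: R] (fine \o g).
  by apply: open_integrable_locally => //; exact: openT.
have := FTC1 gintI locg.
apply: filterS; first exact: (ae_filter_ringOfSetsType mu).
move=> x /= dF /andP[ax xb]; have [] := dF; first by rewrite lte_fin.
set F := fun _ => _ in dF * => dFx F'x.
have hF y : a <= y <= b -> F y - L * (y - a) + h a = h y.
  by move=> /FE; rewrite -[\int[mu]_(_ in _) _]/(F y) => <-; ring.
clearbody F; have {dFx F'x} dF' : is_derive x 1 F (fine (g x)).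
  by apply: DeriveDef => //; rewrite -derive1E.
have dG : is_derive x 1 (fun y => F y - L * (y - a) + h a) (fine (g x) - L).
  by apply: is_derive_eq; rewrite subr0 addr0 /GRing.scale/= mulr1.
(* The two functions agree on [a, b] only, which is a neighbourhood of the interior point [x]. *)
apply: near_eq_is_derive dG; near=> y.
apply: hF; apply/andP; split; near: y; apply: filterS;
  [move=> ?; exact: ltW|exact: lt_nbhsr|move=> ?; exact: ltW|exact: lt_nbhsl].
Unshelve. all: by end_near. Qed.

Lemma lipschitz_ae_slope : {ae mu, forall x, exists b, slope_at h x b}.
Proof.
(* The line is exhausted by countably many intervals; the extra 1 keeps the one for [k = 0]
   nonempty. *)
have : {ae mu, forall x, forall k : nat,
    - k%:R - 1 < x < k%:R + 1 -> exists b, slope_at h x b}.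
  apply/ae_foralln => k.
  have [|g [_ _ _]] := @lipschitz_FTC (- k%:R - 1) (k%:R + 1).
    by have := ler0n R k; lra.
  apply: filterS; first exact: (ae_filter_ringOfSetsType mu).
  move=> x /[apply] dx; exists (g x - L).
  exact/is_derive_slope_at.
apply: filterS; first exact: (ae_filter_ringOfSetsType mu).
move=> x /(_ (Num.bound `|x|)); apply; apply/andP.
have := archi_boundP (normr_ge0 x).
by rewrite ltr_norml => /andP[]; split; lra.
Qed.

(** Almost everywhere the slope is [g - L], so the density [g] is at least [c + L]; integrating this
    bound gives the increment. *)
Lemma lipschitz_mean_value a b c : a < b ->
  {ae mu, forall x, a < x < b -> exists2 d, c <= d & slope_at h x d} ->
  c * (b - a) <= h b - h a.
Proof.
move=> ab aec; have [g [g0 ig gE aeg]] := lipschitz_FTC ab.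
(* The comparison of integrals is between nonnegative functions, and [c + L] may be negative; since
   [g] is nonnegative, the maximum with 0 is still a lower bound. *)
pose m := Num.max (c + L) 0.
have mg : {ae mu, forall x, `]a, b[%classic x -> (m%:E <= (g x)%:E)%E}.
  move: aec aeg; apply: filterS2; first exact: (ae_filter_ringOfSetsType mu).
  move=> x + dg /=; rewrite in_itv/= => dc xab.
  have [d cd hd] := dc xab.
  have E : d = g x - L.
    by have /is_derive_slope_at[_ <-] := hd; have [_ <-] := dg xab.
  by rewrite lee_fin ge_max g0 andbT -(lerD2r (- L)) addrK -E.
have := gE b; rewrite lexx ltW// => /(_ erefl) E.
suff : m * (b - a) <= \int[mu]_(t in `]a, b]) g t.
  rewrite -E; have : c + L <= m by rewrite le_max lexx.
  by move=> /(@ler_wpM2r _ (b - a)) - /(_ ltac:(lra)); lra.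
have /integrableP[mg' _] := ig.
rewrite /Rintegral -integral_itv_bndo_bndc; last by apply: measurable_funS mg'.
rewrite -lee_fin fineK; last first.
  by apply: integrable_fin_num => //; apply: integrableS ig.
apply: le_trans (ae_ge0_le_integral _ _ _ _ _ mg) => //.
- rewrite integral_cst//= lebesgue_measure_itv/= lte_fin ab.
  by rewrite -EFinD -EFinM.
- by move=> x _; rewrite lee_fin le_max lexx orbT.
- by move=> x _; rewrite lee_fin.
- by apply: measurable_funS mg'.
Qed.

End lipschitz_real.

(** * Lebesgue density points *)

Section density.
Context {R : realType}.
Notation mu := (@lebesgue_measure R).

(** If [A] missed the ball of radius e|s| about x + s, it would miss a proportion e / (1 + e) of the
    ball of radius (1 + e)|s| about x. At a density point this proportion is eventually below e / 2,
    which is impossible for e <= 1. *)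
Lemma ae_density_approach (A : set R) : measurable A ->
  {ae mu, forall x, A x -> forall e, 0 < e -> exists2 d, 0 < d &
    forall s, `|s| < d -> exists2 r, `|r - s| <= e * `|s| & A (x + r)}.
Proof.
move=> mA; have := lebesgue_density mA.
apply: filterS; first exact: (ae_filter_ringOfSetsType mu).
move=> x; rewrite indicE => + Ax; rewrite mem_set//= => dA e0 e0_gt0.
(* The final inequality e / 2 <= e / (1 + e) requires e <= 1. *)
pose e := Num.min e0 1.
have e_gt0 : 0 < e by rewrite lt_min e0_gt0 ltr01.
have e1 : e <= 1 by rewrite ge_min lexx orbT.
have ee0 : e <= e0 by rewrite ge_min lexx.
have /fine_cvgP[[d1 /= d1_gt0 fd1] /cvgrPdist_lt] := dA.
have e2 : 0 < e / 2 by rewrite divr_gt0.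
move=> /(_ _ e2)[d2 /= d2_gt0 fd2].
pose d := Num.min d1 d2.
exists (d / 2); first by rewrite divr_gt0// lt_min d1_gt0.
move=> s sd; have [->|s0] := eqVneq s 0.
  by exists 0; rewrite ?subrr ?normr0 ?mulr0 ?addr0.
have s_gt0 : 0 < `|s| by rewrite normr_gt0.
apply: contrapT => noA.
pose rho := (1 + e) * `|s|.
have rho_gt0 : 0 < rho by rewrite mulr_gt0// addr_gt0.
have rhod : rho < d.
  by have := ler_wpM2r (ltW s_gt0) e1; rewrite /rho mulrDl !mul1r; lra.
have [rho1 rho2] : rho < d1 /\ rho < d2.
  by move: rhod; rewrite lt_min => /andP.
have rhoB (dd : R) : rho < dd -> ball_ Num.norm 0 dd rho.
  by rewrite /= sub0r normrN gtr0_norm.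
have F1 := fd1 _ (rhoB _ rho1) rho_gt0.
have {fd2} := fd2 _ (rhoB _ rho2) rho_gt0.
set m := (_ * _)%E in F1 *.
rewrite /= -/m => F2.
have eBr : 0 <= e * `|s| by rewrite mulr_ge0// ltW.
have mB (y r : R) : measurable (ball y r) by exact: measurable_ball.
have disj : [disjoint (A `&` ball x rho) & ball (x + s) (e * `|s|)].
  apply/disj_setPS => y [[Ay _] yB]; apply: noA; exists (y - x).
    rewrite ltW//; move: yB; rewrite /ball/= distrC => yB.
    rewrite (_ : y - x - s = y - (x + s)); last by ring.
    by rewrite (lt_le_trans yB)// ler_wpM2r.
  by rewrite addrC subrK.
have sub : (A `&` ball x rho) `|` ball (x + s) (e * `|s|) `<=` ball x rho.
  move=> y [[]//|]; rewrite /ball/= => yB.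
  rewrite (_ : x - y = (x + s - y) - s); last by ring.
  by rewrite (le_lt_trans (ler_normB _ _))// /rho mulrDl mul1r addrC ltrD2l.
have mAB : measurable (A `&` ball x rho) by exact: measurableI.
have : (mu (A `&` ball x rho) + mu (ball (x + s)%R (e * `|s|)%R) <=
    mu (ball x rho))%E.
  rewrite -measureU; [|exact: mAB|exact: mB|exact/disj_set2P].
  apply: le_measure; rewrite ?inE//=.
    exact: (measurableU _ _ mAB (mB _ _)).
  exact: mB.
rewrite !lebesgue_measure_ball ?(ltW rho_gt0)//.
have Fm : mu (A `&` ball x rho) = (fine m * (rho *+ 2))%:E.
  rewrite EFinM fineK// /m lebesgue_measure_ball ?(ltW rho_gt0)//.
  rewrite inver mulrn_eq0/= gt_eqF// -muleA -EFinM mulVf ?mule1//.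
  by rewrite mulrn_eq0/= gt_eqF.
rewrite Fm -EFinD lee_fin.
rewrite /rho !mulr2n; have le1 := ler_norm (1 - fine m).
have m1 : 1 - e / 2 < fine m by lra.
move: (fine m) m1 => fm m1 H; clear -m1 H e_gt0 e1 s_gt0.
have {}H : 2 * `|s| * ((1 + e) * (fm - 1) + e) <= 0 by lra.
move: H; rewrite pmulr_rle0 ?mulr_gt0//.
have : 0 < (1 + e) * (fm - 1 + e / 2) by apply: mulr_gt0; lra.
have : 0 <= e * (1 - e) by apply: mulr_ge0; lra.
lra.
Qed.

End density.

(** * Borel sets that are null on parallel lines *)

Lemma exists_inv_lt {R : realType} (e : R) : 0 < e ->
  exists k : nat, k.+1%:R^-1 < e.
Proof.
move=> e0; exists (Num.bound e^-1); rewrite invf_plt ?posrE//.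
by rewrite (lt_le_trans (archi_boundP _)) ?invr_ge0 ?(ltW e0)// ler_nat.
Qed.

Lemma rat_approx {R : realType} (x e : R) : 0 < e ->
  exists q : rat, `|x - ratr q| < e.
Proof.
move=> e0; have /rat_in_itvoo[q] : x - e < x + e by lra.
rewrite in_itv/= => /andP[qx xq]; exists q.
by rewrite ltr_norml; apply/andP; split; lra.
Qed.

Section borel.
Context {R : realType} {n : nat}.
Notation mu := (@lebesgue_measure R).
Implicit Types (A : set 'rV[R]_n) (v x : 'rV[R]_n).

Definition borel A := <<s [set O : set 'rV[R]_n | open O] >> A.

Lemma borel_open A : open A -> borel A.
Proof. by move=> oA; exact: sub_sigma_algebra. Qed.

Lemma borelC A : borel A -> borel (~` A).
Proof.
exact: (@measurableC _ (g_sigma_algebraType [set O : set 'rV[R]_n | open O])).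
Qed.

Lemma borel_closed A : closed A -> borel A.
Proof.
by move=> cA; have := borelC (borel_open (closed_openC cA)); rewrite setCK.
Qed.

Lemma borel_bigcup (I : countType) (F : I -> set 'rV[R]_n) :
  (forall i, borel (F i)) -> borel (\bigcup_i F i).
Proof.
exact: (@countable_bigcupT_measurable _ (g_sigma_algebraType _) _ _
  (countableP _)).
Qed.

Lemma borelU A B : borel A -> borel B -> borel (A `|` B).
Proof.
exact: (@measurableU _ (g_sigma_algebraType [set O : set 'rV[R]_n | open O])).
Qed.

Lemma ball_rV x (r : R) y : 0 < r ->
  ball x r y <-> forall i, `|x 0 i - y 0 i| < r.
Proof.
move=> r0; split=> [[_ xy] i|xy]; first exact: xy.
by split=> // i j; rewrite (ord1 i); exact: xy.
Qed.

Lemma rat_approx_rV x (e : R) : 0 < e ->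
  exists q : 'rV[rat]_n, forall i, `|x 0 i - ratr (q 0 i)| < e.
Proof.
move=> e0.
have /choice[q qP] i := rat_approx (x 0 i) e0.
by exists (\row_i q i) => i; rewrite mxE.
Qed.

(** An open set is the countable union of the balls with rational centre and radius 1 / (k + 1) that
    it contains; for the sup norm, membership in a ball is a finite conjunction of conditions on
    coordinates. *)
Lemma open_preimage d (T : measurableType d) (f : T -> 'rV[R]_n) A :
  (forall i, measurable_fun setT (fun t => f t 0 i)) -> open A ->
  measurable (f @^-1` A).
Proof.
move=> mf oA.
pose B (p : 'rV[rat]_n * nat) :=
  ball (map_mx ratr p.1 : 'rV[R]_n) (p.2.+1%:R^-1).
have AE : A = \bigcup_p [set y | B p y /\ B p `<=` A].
  apply/seteqP; split=> [y Ay|y [p _ [py /(_ _ py)]]//].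
  have /nbhs_ballP[e /= e0 yeA] : nbhs y A by exact: open_nbhs_nbhs.
  (* The radius is below e / 2, so that a ball of this radius containing [y] lies in the ball of
     radius [e] about [y]. *)
  have [k ke] := exists_inv_lt (divr_gt0 e0 (ltr0n R 2)).
  have k0 : 0 < k.+1%:R^-1 :> R by rewrite invr_gt0.
  have [q yq] := rat_approx_rV y k0.
  exists (q, k) => //; split.
    by apply/ball_rV => //= i; rewrite mxE distrC.
  move=> z /ball_rV - /(_ k0)/= qz; apply: yeA; apply/ball_rV => // i.
  rewrite (le_lt_trans (ler_distD (ratr (q 0 i)) _ _))//.
  by rewrite (splitr e) ltrD// (lt_trans _ ke)//; have := qz i; rewrite mxE.
rewrite AE preimage_bigcup; apply: countable_bigcupT_measurable.
  exact: countableP.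
move=> [q k]; have [qA|qA] := pselect (B (q, k) `<=` A); last first.
  rewrite (_ : _ @^-1` _ = set0)//.
  by apply/seteqP; split => // t [].
rewrite (_ : _ @^-1` _ = \bigcap_(i in [set: 'I_n])
    ((fun t => f t 0 i) @^-1` ball (ratr (q 0 i) : R) (k.+1%:R^-1))).
  apply: fin_bigcap_measurable; first exact: finite_finset.
  move=> i _; rewrite -[X in measurable X]setTI; apply: mf => //.
  exact: measurable_ball.
apply/seteqP; split => t /=.
  move=> [/ball_rV fq _] i _; rewrite /ball/=.
  by have := fq _ i; rewrite mxE; apply; rewrite invr_gt0.
move=> fq; split => //; apply/ball_rV; first by rewrite invr_gt0.
by move=> i; rewrite mxE; exact: fq.
Qed.

Lemma borel_preimage d (T : measurableType d) (f : T -> 'rV[R]_n) A :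
  (forall i, measurable_fun setT (fun t => f t 0 i)) -> borel A ->
  measurable (f @^-1` A).
Proof.
move=> mf bA; have := @smallest_sub _ (sigma_algebra setT)
  [set O : set 'rV[R]_n | open O] [set B | measurable (f @^-1` B)].
apply => //.
  split => /=; first by rewrite preimage_set0.
  - by move=> B mB; rewrite setTD preimage_setC; exact: measurableC.
  - by move=> F mF; rewrite preimage_bigcup; exact: bigcupT_measurable.
by move=> O; exact: open_preimage.
Qed.

Lemma borel_shift_preimage d (T : measurableType d) (f : T -> 'rV[R]_n) x A :
  (forall i, measurable_fun setT (fun t => f t 0 i)) -> borel A ->
  measurable [set t | A (x + f t)].
Proof.
move=> mf bA; apply: (borel_preimage (f := fun t => x + f t)) bA => i.
under eq_fun do rewrite mxE.
exact: measurable_funD.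
Qed.

Definition line_null v A := forall x, mu [set t | A (x + t *: v)] = 0%E.

End borel.

(** * Fubini's theorem along lines *)

Section fubini.
Context {R : realType} {n : nat}.
Notation mu := (@lebesgue_measure R).

(** The random vector [f] is a combination of the vectors in [vs] with independent coefficients,
    uniform on [0, eta]. By Fubini the coefficient of [v] may be integrated first; it then runs
    along a line parallel to [v], on which [A] is null. *)
Lemma prob_lines (eta : R) (vs : seq 'rV[R]_n) : 0 < eta ->
  exists d (T : measurableType d) (P : probability T R) (f : T -> 'rV[R]_n),
  [/\ forall i, measurable_fun setT (fun t => f t 0 i),
      forall t, `|f t| <= eta * \sum_(v <- vs) `|v| &
      forall A v x, borel A -> v \in vs -> line_null v A ->
        P [set t | A (x + f t)] = 0%E].
Proof.
move=> eta0; elim: vs => [|v vs [d [T [P [f [mf f_le fnull]]]]]].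
  exists _, unit, (dirac tt : probability unit R), (fun=> 0); split => //.
  by move=> _; rewrite normr0 big_nil mulr0.
pose Q : probability (measurableTypeR R) R := uniform_prob eta0.
(* The clamp makes [f] bounded everywhere and not just almost everywhere. *)
pose c (r : R) := Num.max 0 (Num.min r eta).
have mc : measurable_fun setT c.
  by apply: measurable_maxr => //; apply: measurable_minr.
pose g (z : T * measurableTypeR R) := f z.1 + c z.2 *: v.
have mg (i : 'I_n) : measurable_fun setT (fun z => g z 0 i).
  rewrite (_ : (fun z => _) = (fun z => f z.1 0 i + c z.2 * v 0 i)); last first.
    by apply/funext => z; rewrite !mxE.
  apply: measurable_funD.
    by apply: (measurableT_comp (mf i)).
  apply: measurable_funM => //.
  by apply: (measurableT_comp mc).
exists _, (T * measurableTypeR R)%type, (P \x Q)%E, g; split => //.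
- move=> z; rewrite big_cons mulrDr addrC (le_trans (ler_normD _ _))//.
  rewrite lerD// normrZ ler_wpM2r// ger0_norm ?le_max ?lexx//.
  by rewrite ge_max ge_min lexx orbT ltW.
move=> A w x bA; rewrite inE => wvs wA.
pose B := [set z | A (x + g z)].
have mB : measurable B by exact: borel_shift_preimage.
(* If [w] is the new vector, the new coefficient is integrated first; otherwise it is frozen,
   shifting the base point, and the induction hypothesis applies to [f]. *)
rewrite -/B; move: wvs => /predU1P[wv|wvs].
  rewrite {w}wv in wA.
  have Qv y : Q [set r | A (y + c r *: v)] = 0%E.
    (* [Q] lives on [0, eta], where the clamp is the identity, and it is dominated by Lebesgue
       measure. *)
    transitivity (Q [set r | A (y + r *: v)]); last first.
      have /null_content_dominatesP := dominates_uniform_prob eta0; apply.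
      - apply: (@borel_preimage _ _ _ (measurableTypeR R)
        (fun r => y + r *: v)) bA => i.
        under eq_fun do rewrite !mxE.
        by apply: measurable_funD => //; exact: measurable_funM.
      - exact: wA.
    rewrite /Q /= /uniform_prob.
    rewrite [LHS]integral_uniform_pdf [RHS]integral_uniform_pdf.
    congr (integral _ _ _); apply/seteqP; split=> r /= [+ /[dup] r01];
      rewrite in_itv/= => Ar /andP[r0 r1]; split => //; move: Ar;
      by rewrite /c min_l// max_r.
  rewrite /product_measure1; apply: integral0_eq => t _ /=.
  rewrite (_ : xsection B t = [set r | A (x + f t + c r *: v)]).
    exact: Qv.
  by apply/seteqP; split => r; rewrite xsectionP /B/= /g/= addrA.
transitivity (\int[P]_t (Q \o xsection B) t)%E => //.
rewrite -indic_fubini_tonelli_FE// indic_fubini_tonelli//.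
rewrite indic_fubini_tonelli_GE//; apply: integral0_eq => r _ /=.
rewrite (_ : ysection B r = [set t | A (x + c r *: v + f t)]).
  exact: fnull wvs wA.
apply/seteqP; split => t; rewrite ysectionP /B/= /g/=;
  by rewrite (_ : x + (f t + c r *: v) = x + c r *: v + f t)// addrA addrAC.
Qed.

(** The axis may change with the index [k]. Asking for a covering makes the notion pass to
    subsets. *)
Definition coord_null (N : set 'rV[R]_n) := exists A : nat -> set 'rV[R]_n,
  (forall k, borel (A k) /\ exists i, line_null (delta_mx 0 i) (A k)) /\
  N `<=` \bigcup_k A k.

(** For each fixed [s], the random point x + f(t) + s d almost surely avoids every [A k]. Exchanging
    the order of integration, for almost every [t] the line through x + f(t) in direction [d] meets
    their union in a null set; any such f(t) serves as [z]. *)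
Lemma coord_null_line N x d (eta : R) : 0 < eta -> coord_null N ->
  exists z : 'rV[R]_n, `|z| <= eta /\
    mu.-negligible [set s | N (x + z + s *: d)].
Proof.
move=> eta0 [A [bA NA]].
pose vs := [seq delta_mx 0 i : 'rV[R]_n | i <- enum 'I_n].
(* The 1 keeps the divisor positive; dividing by [C] makes |f| at most [eta]. *)
pose C : R := \sum_(v <- vs) `|v| + 1.
have C0 : 0 < C by rewrite ltr_wpDl// sumr_ge0.
have [dd [T [P [f [mf f_le fnull]]]]] := prob_lines vs (divr_gt0 eta0 C0).
pose G := \bigcup_k A k.
have bG : borel G by apply: borel_bigcup => k; case: (bA k).
pose B := [set z : T * measurableTypeR R | G (x + f z.1 + z.2 *: d)].
have mB : measurable B.
  apply: (borel_preimage (f := fun z : T * measurableTypeR R =>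
    x + f z.1 + z.2 *: d)) bG => i.
  under eq_fun do rewrite !mxE.
  apply: measurable_funD.
    by apply: measurable_funD => //; exact: (measurableT_comp (mf i)).
  apply: measurable_funM => //; exact: measurable_snd.
have yB s : P (ysection B s) = 0%E.
  have -> : ysection B s = \bigcup_k [set t | A k (x + s *: d + f t)].
    apply/seteqP; split => t; rewrite ysectionP /B/=;
      by rewrite (_ : x + f t + s *: d = x + s *: d + f t)// addrAC.
  apply/negligibleP.
    apply: bigcupT_measurable => k.
    by apply: borel_shift_preimage => //; case: (bA k).
  apply: negligible_bigcup => k; have [bAk [i Aki]] := bA k.
  apply/negligibleP; first exact: borel_shift_preimage.
  apply: fnull Aki => //; apply/mapP; exists i => //; exact: mem_enum.
have I0 : (\int[P]_t `|mu (xsection B t)| = 0)%E.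
  transitivity (\int[P]_t (mu \o xsection B) t)%E.
    by apply: eq_integral => t _; rewrite gee0_abs.
  rewrite -indic_fubini_tonelli_FE// indic_fubini_tonelli//.
  by rewrite indic_fubini_tonelli_GE//; apply: integral0_eq => s _; exact: yB.
have mxB : measurable_fun setT (fun t => mu (xsection B t)).
  exact: measurable_fun_xsection.
have [N' [mN' N'0 sub]] := (ae_eq_integral_abs _ measurableT mxB).1 I0.
(* The null set [N'] is not the whole space, which has probability 1. *)
have [t tN'] : exists t, ~ N' t.
  apply/existsNP => N'T; have := @probability_setT _ _ _ P.
  have -> : setT = N'.
    by apply/seteqP; split => // t _; apply: contrapT; exact: N'T.
  by rewrite N'0 => /esym/eqP; rewrite onee_eq0.
have muB0 : mu (xsection B t) = 0%E.
  by apply: contrapT => h; apply: tN'; apply: sub => /= /(_ I).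
exists (f t); split.
  rewrite (le_trans (f_le t))// -mulrA ler_piMr ?(ltW eta0)//.
  by rewrite mulrC ler_pdivrMr// mul1r lerDl.
exists (xsection B t); split => //; first exact: measurable_xsection.
by move=> s /= /NA Gs; rewrite xsectionP.
Qed.

End fubini.

(** * Coordinates, inner product and sup norm *)

Section row_vectors.
Context {R : realType} {n : nat}.
Implicit Types (x y a h : 'rV[R]_n).

Lemma le_coord_norm x i : `|x 0 i| <= `|x|.
Proof. by rewrite [leRHS]mx_normrE; apply: (le_bigmax _ _ (0, i)). Qed.

Lemma norm_rV_le x c : 0 <= c -> (forall i, `|x 0 i| <= c) -> `|x| <= c.
Proof.
move=> c0 xc; rewrite [leLHS]mx_normrE; apply: bigmax_le => // -[j i] _ /=.
by rewrite (ord1 j).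
Qed.

Lemma norm_delta_rV (k : 'I_n) : `|delta_mx 0 k : 'rV[R]_n| = 1.
Proof.
apply/eqP; rewrite eq_le; apply/andP; split.
  apply: norm_rV_le => // i; rewrite mxE eqxx/=.
  by case: eqP => _; rewrite ?normr1 ?normr0.
by apply: le_trans (le_coord_norm _ k); rewrite mxE !eqxx normr1.
Qed.

Lemma dotDr a x y : dot a (x + y) = dot a x + dot a y.
Proof.
by rewrite /dot -big_split; apply: eq_bigr => i _; rewrite mxE mulrDr.
Qed.

Lemma dotZr a (c : R) x : dot a (c *: x) = c * dot a x.
Proof.
by rewrite /dot mulr_sumr; apply: eq_bigr => i _; rewrite mxE mulrCA.
Qed.

Lemma dotBl a b x : dot (a - b) x = dot a x - dot b x.
Proof. by rewrite /dot -sumrB; apply: eq_bigr => i _; rewrite !mxE mulrBl. Qed.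

Lemma dotBr a x y : dot a (x - y) = dot a x - dot a y.
Proof. by rewrite dotDr -scaleN1r dotZr mulN1r. Qed.

Lemma dot_delta a (k : 'I_n) : dot a (delta_mx 0 k) = a 0 k.
Proof.
rewrite /dot (bigD1 k)//= big1 ?addr0 ?mxE ?eqxx ?mulr1// => i ik.
by rewrite mxE (negbTE ik) mulr0.
Qed.

Lemma dot_le a h (c : R) : (forall i, `|a 0 i| <= c) ->
  `|dot a h| <= n%:R * c * `|h|.
Proof.
move=> ac; rewrite (le_trans (ler_norm_sum _ _ _))//.
apply: (@le_trans _ _ (\sum_(i < n) c * `|h|)).
  by apply: ler_sum => i _; rewrite normrM ler_pM// le_coord_norm.
by rewrite sumr_const card_ord -[leLHS]mulr_natl mulrA.
Qed.

End row_vectors.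

(** The intervals [u j - e j, u j + e j] meet pairwise, so the supremum of their left ends lies in
    all of them. *)
Lemma nested_limit {R : realType} (u e : nat -> R) :
  (forall j l, u j - e j <= u l + e l) -> exists b, forall j, `|u j - b| <= e j.
Proof.
move=> ue; pose S := [set u j - e j | j in setT].
have Sub l : ubound S (u l + e l) by move=> _ [j _ <-]; exact: ue.
exists (sup S) => j; rewrite ler_norml; apply/andP; split.
  have : sup S <= u j + e j.
    by apply: ge_sup; [exists (u 0 - e 0), 0%N|exact: Sub].
  lra.
have : u j - e j <= sup S.
  apply: sup_upper_bound; last by exists j.
  by split; [exists (u 0 - e 0), 0%N|exists (u 0 + e 0)].
lra.
Qed.

(** * Operations on exceptional sets *)

Section coord_null.
Context {R : realType} {n : nat}.
Implicit Types N M : set 'rV[R]_n.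

Lemma coord_nullS N M : N `<=` M -> coord_null M -> coord_null N.
Proof.
by move=> NM [A [hA MA]]; exists A; split=> //; exact: subset_trans MA.
Qed.

Lemma coord_null_bigcup (I : countType) (i0 : I) (N : I -> set 'rV[R]_n) :
  (forall i, coord_null (N i)) -> coord_null (\bigcup_i N i).
Proof.
move=> /choice[A hA].
(* The pair with [i0] is a default for the integers that encode no pair. *)
pose B m := let p := odflt (i0, 0%N) (unpickle m) in A p.1 p.2.
exists B; split; first by move=> m; exact: (hA _).1.
move=> x [i _ /(hA i).2[k _ xA]]; exists (pickle (i, k)) => //.
by rewrite /B pickleK.
Qed.

Lemma coord_nullU N M : coord_null N -> coord_null M -> coord_null (N `|` M).
Proof.
move=> N0 M0; apply: (@coord_nullS _ (\bigcup_b if b then N else M)).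
  by move=> x [Nx|Mx]; [exists true|exists false].
by apply: (coord_null_bigcup true) => -[].
Qed.

Lemma coord_null1 N (k : 'I_n) : borel N -> line_null (delta_mx 0 k) N ->
  coord_null N.
Proof.
move=> bN Nk; exists (fun=> N); split=> [_|x Nx]; last by exists 0%N.
by split=> //; exists k.
Qed.

(** The index [k] witnesses that the dimension is positive: even the empty set has to be assigned an
    axis. *)
Lemma coord_null0 (k : 'I_n) : coord_null (set0 : set 'rV[R]_n).
Proof.
apply: (coord_null1 (k := k)).
  by apply: borel_open; exact: open0.
by move=> x; rewrite [X in lebesgue_measure X](_ : _ = set0) ?measure0.
Qed.

End coord_null.

(** * Rademacher's theorem *)

Section rademacher.
Context {R : realType} {n : nat}.
Variables (f : 'rV[R]_n -> R) (L : R).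
Hypothesis L0 : 0 < L.
Hypothesis fL : forall x y, `|f x - f y| <= L * `|x - y|.
Implicit Types (x h a : 'rV[R]_n) (S : set 'rV[R]_n) (k : 'I_n).
Notation mu := (@lebesgue_measure R).

Let cf : continuous f.
Proof. exact: (@lipschitz_continuous R 'rV[R]_n R f L L0 fL). Qed.

(** With precision [e] and scale [d] fixed, this is a closed set, hence Borel; differentiability is
    later expressed through countably many such sets. *)
Definition lin_approx S a (e d : R) : set 'rV[R]_n :=
  [set x | forall h, S h -> `|h| < d ->
     `|f (x + h) - f x - dot a h| <= e * `|h|].

Definition axis k : set 'rV[R]_n := [set t *: delta_mx 0 k | t in [set: R]].

Definition prefix_space (k : nat) : set 'rV[R]_n :=
  [set h | forall i : 'I_n, (k <= i)%N -> h 0 i = 0].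

Lemma lin_approx_closed S a e d : closed (lin_approx S a e d).
Proof.
rewrite (_ : lin_approx S a e d = \bigcap_(h in [set h | S h /\ `|h| < d])
    ((fun x => `|f (x + h) - f x - dot a h|) @^-1` [set r | r <= e * `|h|])).
  apply: closed_bigI => h _; apply: preimage_closed; last exact: closed_le.
  move=> x _; apply: (@lipschitz_continuous _ _ _ _ (L + L)).
    by rewrite addr_gt0.
  move=> y z; rewrite (le_trans (ler_dist_dist _ _))//.
  rewrite (_ : _ - _ = (f (y + h) - f (z + h)) - (f y - f z)); last by ring.
  rewrite mulrDl (le_trans (ler_normB _ _))// lerD//.
  by rewrite (le_trans (fL _ _))// opprD addrACA subrr addr0.
apply/seteqP; split=> x; first by move=> xa h [Sh hd]; exact: xa.
by move=> xa h Sh hd; exact: xa.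
Qed.

Lemma lin_approx_le S a e d e' d' : e <= e' -> d' <= d ->
  lin_approx S a e d `<=` lin_approx S a e' d'.
Proof.
move=> ee' dd' x xa h Sh hd.
by rewrite (le_trans (xa _ Sh (lt_le_trans hd dd')))// ler_wpM2r.
Qed.

Lemma lin_approx_eq_dot S a a' e d : (forall h, S h -> dot a h = dot a' h) ->
  lin_approx S a e d `<=` lin_approx S a' e d.
Proof. by move=> aa' x xa h Sh; rewrite -aa'//; exact: xa. Qed.

(** Test the approximation on a step of length d / 2 along the axis, over which [f] varies by at
    most L d / 2. *)
Lemma lin_approx_axis_le k a e d x : 0 < d ->
  lin_approx (axis k) a e d x -> `|a 0 k| <= L + e.
Proof.
move=> d0 xa; pose h : 'rV[R]_n := (d / 2) *: delta_mx 0 k.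
have nh : `|h| = d / 2.
  by rewrite normrZ norm_delta_rV mulr1 gtr0_norm// divr_gt0.
have := xa h; rewrite nh => /(_ (imageP _ I)) - /(_ ltac:(lra)).
have := fL (x + h) x; rewrite [x + h - x]addrAC subrr add0r nh dotZr dot_delta.
move: (f _ - f _) => y y1 y2.
have d2 : 0 < d / 2 by rewrite divr_gt0.
rewrite -(ler_pM2l d2) -[X in X * `|_|](gtr0_norm d2) -normrM.
have := ler_normB y (y - d / 2 * a 0 k); rewrite opprB addrC subrK; lra.
Qed.

(* Slide along the axis from [x + t e_k] to a nearby point of the set on which
   the approximation in the directions of the prefix space is known. *)
Lemma lin_approx_extend k a (e d : R) x : 0 < e <= 1 -> 0 < d ->
  let A := lin_approx (prefix_space k) a e d `&` lin_approx (axis k) a e d in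
  A x ->
  (exists2 d1, 0 < d1 & forall s, `|s| < d1 ->
     exists2 r, `|r - s| <= e * `|s| & A (x + r *: delta_mx 0 k)) ->
  exists m : nat,
    lin_approx (prefix_space k.+1) a ((2 * L + 4) * e) m.+1%:R^-1 x.
Proof.
move=> /andP[e0 e1] d0 A Ax [d1 d1_gt0 xA].
have ak : `|a 0 k| <= L + 1.
  by rewrite (le_trans (lin_approx_axis_le d0 Ax.2))// lerD2l.
(* The sliding parameter [r] satisfies |r| <= 2|h|, which must stay below [d]. *)
have [m md] : exists m : nat, m.+1%:R^-1 < Num.min d1 (d / 2).
  have dd : 0 < Num.min d1 (d / 2) by rewrite lt_min d1_gt0 divr_gt0.
  exact: exists_inv_lt.
exists m => h Sh /lt_trans/(_ md); rewrite lt_min => /andP[hd1 hd].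
pose t := h 0 k; pose h' := h - t *: delta_mx 0 k.
have th : `|t| <= `|h| by exact: le_coord_norm.
have h'h : `|h'| <= `|h|.
  apply: norm_rV_le => // i; rewrite !mxE eqxx/=; case: (eqVneq i k) => [->|ik].
    by rewrite mulr1 subrr normr0.
  by rewrite mulr0 subr0 le_coord_norm.
have Sh' : prefix_space k h'.
  move=> i ki; rewrite !mxE eqxx/=; case: (eqVneq i k) => [->|ik].
    by rewrite mulr1 subrr.
  rewrite mulr0 subr0 Sh// ltn_neqAle ki andbT.
  by apply: contraNneq ik => ki'; apply/eqP/val_inj.
have [r rt Ay] := xA _ (le_lt_trans th hd1).
pose y := x + r *: delta_mx 0 k.
have re : `|r *: delta_mx 0 k : 'rV[R]_n| = `|r|.
  by rewrite normrZ norm_delta_rV mulr1.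
have rt2 : `|r| <= 2 * `|t|.
  have := ler_normD (r - t) t; rewrite subrK => /le_trans; apply.
  have : e * `|t| <= 1 * `|t| by rewrite ler_wpM2r.
  lra.
(* The four errors are [L], 1, 2 and [L + 1] times e|h|; together they give the constant 2L + 4. *)
have E1 : `|f (x + h) - f (y + h')| <= L * (e * `|h|).
  rewrite (le_trans (fL _ _))// ler_wpM2l ?(ltW L0)//.
  rewrite (_ : _ - _ = (t - r) *: delta_mx 0 k); last first.
    by apply/rowP => i; rewrite !mxE; ring.
  rewrite normrZ norm_delta_rV mulr1 distrC (le_trans rt)//.
  by rewrite ler_wpM2l ?(ltW e0).
have E2 : `|f (y + h') - f y - dot a h'| <= e * `|h|.
  rewrite (le_trans (Ay.1 _ Sh' _))//; first lra.
  by rewrite ler_wpM2l ?(ltW e0).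
have E3 : `|f y - f x - r * a 0 k| <= e * (2 * `|h|).
  rewrite -dot_delta -dotZr (le_trans (Ax.2 _ _ _))//; first by exists r.
    by rewrite re; lra.
  by rewrite re ler_wpM2l ?(ltW e0)//; lra.
have E4 : `|(r - t) * a 0 k| <= e * `|h| * (L + 1).
  rewrite normrM ler_pM// (le_trans rt)//.
  by rewrite ler_wpM2l ?(ltW e0).
rewrite (_ : _ - _ = (f (x + h) - f (y + h')) + (f (y + h') - f y - dot a h')
  + (f y - f x - r * a 0 k) + (r - t) * a 0 k); last first.
  by rewrite /h' dotDr -scaleNr dotZr dot_delta; ring.
rewrite (le_trans (ler_normD _ _))//.
rewrite (le_trans (lerD (ler_normD _ _) (lexx _)))//.
have := ler_normD (f (x + h) - f (y + h')) (f (y + h') - f y - dot a h').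
lra.
Qed.

Lemma line_null_section k (A : set 'rV[R]_n) : borel A ->
  (forall x, {ae mu, forall t, ~ A (x + t *: delta_mx 0 k)}) ->
  line_null (delta_mx 0 k) A.
Proof.
move=> bA Ak x; apply: measure_negligible.
  apply: (@borel_shift_preimage _ _ _ (measurableTypeR R)
    (fun t => t *: delta_mx 0 k)) bA => i.
  under eq_fun do rewrite mxE.
  exact: measurable_funM.
have [N [mN N0 NA]] := Ak x; exists N; split=> // t At.
by apply: NA => /=; apply.
Qed.

(** The points where both approximations hold but fail to combine, at whatever scale, into one on
    the next prefix space. *)
Let bad k a (e d : R) :=
  (lin_approx (prefix_space k) a e d `&` lin_approx (axis k) a e d) `\`
  \bigcup_m lin_approx (prefix_space k.+1) a ((2 * L + 4) * e) m.+1%:R^-1.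

(** On each line parallel to the axis, [ae_density_approach] provides, at almost every point of the
    closed set [A], the nearby points of [A] that [lin_approx_extend] asks for. *)
Let bad_null k a (e d : R) : 0 < e <= 1 -> 0 < d -> coord_null (bad k a e d).
Proof.
move=> e01 d0.
set A := lin_approx (prefix_space k) a e d `&` lin_approx (axis k) a e d.
have cA : closed A by apply: closedI; exact: lin_approx_closed.
have bbad : borel (bad k a e d).
  rewrite /bad -/A setDE -[X in borel X]setCK setCI setCK; apply: borelC.
  apply: borelU; first by apply: borelC; exact: borel_closed.
  by apply: borel_bigcup => m; apply: borel_closed; exact: lin_approx_closed.
apply: (coord_null1 (k := k) bbad); apply: line_null_section => // x.
have mA : measurable [set t : R | A (x + t *: delta_mx 0 k)].
  apply: (@borel_shift_preimage _ _ _ (measurableTypeR R)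
    (fun t => t *: delta_mx 0 k)) (borel_closed cA) => i.
  under eq_fun do rewrite mxE.
  exact: measurable_funM.
have := ae_density_approach mA.
apply: filterS; first exact: (ae_filter_ringOfSetsType mu).
move=> t /= tA [At]; apply.
have e0 : 0 < e by case/andP: e01.
have [d1 d1_gt0 H] := tA At _ e0.
have [|m hm] := @lin_approx_extend k a e d _ e01 d0 At; last by exists m.
exists d1 => // s /H[r rs Ar]; exists r => //.
by rewrite -addrA -scalerDl.
Qed.

(** The form [a] is rational, to keep all unions countable, and may vary with the precision;
    [approximable_gradient] recovers a single gradient. *)
Definition approximable S : set 'rV[R]_n := [set x | forall j : nat,
  exists (a : 'rV[rat]_n) (m : nat),
    lin_approx S (map_mx ratr a) j.+1%:R^-1 m.+1%:R^-1 x].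

(** On each line parallel to the axis, [f] is a Lipschitz function of one variable, so it has a
    slope almost everywhere. *)
Lemma approximable_axis k : coord_null (~` approximable (axis k)).
Proof.
pose Q j := \bigcup_(am : 'rV[rat]_n * nat)
  lin_approx (axis k) (map_mx ratr am.1) j.+1%:R^-1 am.2.+1%:R^-1.
apply: (@coord_nullS _ _ _ (\bigcup_j ~` Q j)).
  move=> x /existsNP[j xj]; exists j => // -[[a m] _ xa].
  by apply: xj; exists a, m.
apply: (coord_null_bigcup 0%N) => j.
have bQ : borel (~` Q j).
  apply: borelC; apply: borel_bigcup => am.
  by apply: borel_closed; exact: lin_approx_closed.
apply: (coord_null1 (k := k) bQ); apply: line_null_section => // x.
have hL (s t : R) : `|f (x + s *: delta_mx 0 k) - f (x + t *: delta_mx 0 k)|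
    <= L * `|s - t|.
  rewrite (le_trans (fL _ _))// opprD addrACA subrr add0r -scalerBl.
  by rewrite normrZ norm_delta_rV mulr1.
have := lipschitz_ae_slope L0 hL.
apply: filterS; first exact: (ae_filter_ringOfSetsType mu).
move=> t [b tb]; apply.
(* Half of the precision is spent on the expansion with slope [b], half on replacing [b] by a
   rational. *)
have j0 : 0 < j.+1%:R^-1 / 2 :> R by rewrite divr_gt0 ?invr_gt0.
have [d d0 hd] := tb _ j0.
have [m md] := exists_inv_lt d0.
have [q bq] := rat_approx b j0.
exists (q *: delta_mx 0 k, m) => //= _ [s _ <-].
rewrite normrZ norm_delta_rV mulr1 dotZr dot_delta => /lt_trans/(_ md)/hd.
rewrite !mxE !eqxx mulr1 -[x + _ + _]addrA -scalerDl => H.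
rewrite (_ : _ - s * ratr q = f (x + (t + s) *: delta_mx 0 k) -
   f (x + t *: delta_mx 0 k) - s * b + s * (b - ratr q)); last by ring.
rewrite (le_trans (ler_normD _ _))//.
rewrite [leRHS](_ : _ = j.+1%:R^-1 / 2 * `|s| + `|s| * (j.+1%:R^-1 / 2)).
  2: by field.
by rewrite lerD// normrM ler_wpM2l// ltW.
Qed.

Lemma approximable_prefixS k : coord_null (~` approximable (prefix_space k)) ->
  coord_null (~` approximable (prefix_space k.+1)).
Proof.
move=> null_k.
pose B := \bigcup_(p : 'rV[rat]_n * nat * nat)
  bad k (map_mx ratr p.1.1) p.1.2.+1%:R^-1 p.2.+1%:R^-1.
apply: (@coord_nullS _ _ _ (~` approximable (prefix_space k) `|`
  (~` approximable (axis k) `|` B))); last first.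
  apply: coord_nullU => //; apply: coord_nullU; first exact: approximable_axis.
  apply: (coord_null_bigcup (0, 0%N, 0%N)) => -[[a j] m].
  by apply: bad_null; rewrite invr_gt0 ?ltr0n//= invf_le1// ler1n.
move=> x; apply: contra_notP.
move=> /not_orP[/contrapT x1 /not_orP[/contrapT x2 xB]] j.
pose C := 2 * L + 4.
have C0 : 0 < C by rewrite addr_gt0 ?mulr_gt0.
have j0 : 0 < j.+1%:R^-1 :> R by rewrite invr_gt0.
(* Extending by one coordinate multiplies the error by [C], so one starts from a precision finer
   than that of [j] divided by [C]. *)
have [i iC] := exists_inv_lt (divr_gt0 j0 C0).
have [a1 [m1 xa1]] := x1 i; have [a2 [m2 xa2]] := x2 i.
(* The prefix space does not see coordinate [k] and the axis sees nothing else, so [a1] and [a2]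
   merge into one form. *)
pose a : 'rV[rat]_n := \row_l (if l == k then a2 0 l else a1 0 l).
pose m := maxn m1 m2.
have mle m' : (m' <= m)%N -> m.+1%:R^-1 <= m'.+1%:R^-1 :> R.
  by move=> m'm; rewrite lef_pV2 ?posrE ?ltr0n// ler_nat.
have Ax : (lin_approx (prefix_space k) (map_mx ratr a) i.+1%:R^-1 m.+1%:R^-1 `&`
    lin_approx (axis k) (map_mx ratr a) i.+1%:R^-1 m.+1%:R^-1) x.
  split.
    apply: lin_approx_le (lexx _) (mle m1 (leq_maxl _ _)) _ _.
    apply: lin_approx_eq_dot xa1 => h Sh; apply: eq_bigr => l _; rewrite !mxE.
    by case: eqP => // ->; rewrite Sh// !mulr0.
  apply: lin_approx_le (lexx _) (mle m2 (leq_maxr _ _)) _ _.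
  apply: lin_approx_eq_dot xa2 => _ [t _ <-]; rewrite !dotZr !dot_delta.
  by rewrite !mxE eqxx.
have : ~ bad k (map_mx ratr a) i.+1%:R^-1 m.+1%:R^-1 x.
  by move=> bx; apply: xB; exists (a, i, m).
move=> /not_andP[//|/contrapT[m' _ xm']].
exists a, m'; apply: lin_approx_le (lexx _) _ xm'.
by rewrite mulrC -ler_pdivlMr// ltW.
Qed.

Lemma approximable_setT (k0 : 'I_n) : coord_null (~` approximable setT).
Proof.
have H m : (m <= n)%N -> coord_null (~` approximable (prefix_space m)).
  elim: m => [_|m IHm mn].
    (* The prefix space of length 0 contains only the zero vector. *)
    apply: (coord_nullS _ (coord_null0 k0)) => x; apply => j.
    exists 0, 0%N => h h0 _; suff -> : h = 0.
      rewrite addr0 subrr normr0 mulr0 /dot big1 ?subr0 ?normr0// => i _.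
      by rewrite !mxE mulr0.
    by apply/rowP => i; rewrite mxE h0.
  exact: (approximable_prefixS (k := Ordinal mn) (IHm (ltnW mn))).
rewrite (_ : setT = prefix_space n); first exact: H.
by apply/seteqP; split => // h _ i; rewrite leqNgt ltn_ord.
Qed.

(** Two approximating forms, tested on a common small step along an axis, have coefficients that
    differ by at most the sum of their precisions; the nested intervals around them define the
    gradient. *)
Lemma approximable_gradient x : approximable setT x -> exists b : 'rV[R]_n,
  forall e, 0 < e -> exists2 d, 0 < d & lin_approx setT b e d x.
Proof.
move=> /choice[a] /choice[m xam].
pose A j : 'rV[R]_n := map_mx ratr (a j).
have Aab i j l : A j 0 i - j.+1%:R^-1 <= A l 0 i + l.+1%:R^-1.
  pose d := Num.min (m j).+1%:R^-1 (m l).+1%:R^-1 : R.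
  have d0 : 0 < d by rewrite lt_min !invr_gt0 !ltr0n.
  have d2 : 0 < d / 2 by rewrite divr_gt0.
  pose h : 'rV[R]_n := (d / 2) *: delta_mx 0 i.
  have nh : `|h| = d / 2 by rewrite normrZ norm_delta_rV mulr1 gtr0_norm.
  have hd : `|h| < d by rewrite nh ltr_pdivrMr// ltr_pMr// ltr1n.
  have [hj hl] : `|h| < (m j).+1%:R^-1 /\ `|h| < (m l).+1%:R^-1.
    by move: hd; rewrite lt_min => /andP.
  have := xam j h I hj; have := xam l h I hl.
  rewrite !dotZr !dot_delta nh -!/(A _) => /ler_normlP[_ B1] /ler_normlP[B2 _].
  rewrite -(ler_pM2l d2); move: B1 B2.
  move: (f _ - f x) (A j 0 i) (A l 0 i) j.+1%:R^-1 l.+1%:R^-1 (d / 2).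
  by move=> y u v p q t; lra.
have /choice[b hb] i := nested_limit (Aab i).
exists (\row_i b i) => e e0.
(* One unit of error comes from the approximation by [A j], and [n] units from replacing [A j] by
   [b]. *)
have [j je] := exists_inv_lt (divr_gt0 e0 (ltr0n R n.+1)).
exists (m j).+1%:R^-1 => // h _ hm.
rewrite (_ : _ - _ = f (x + h) - f x - dot (A j) h +
    dot (A j - \row_i b i) h); last first.
  by rewrite dotBl; ring.
rewrite (le_trans (ler_normD _ _))//.
apply: (@le_trans _ _ (j.+1%:R^-1 * `|h| + n%:R * j.+1%:R^-1 * `|h|)).
  by rewrite lerD ?xam// dot_le// => i; have := hb i j; rewrite !mxE.
rewrite -mulrDl ler_wpM2r// ltW//; move: je.
by rewrite ltr_pdivlMr ?ltr0n// -(natr1 n) mulrDr mulr1 addrC [n%:R * _]mulrC.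
Qed.

End rademacher.

(** * Convexity, extension and the Jacobian *)

Lemma convex_setP {R : realType} {V : lmodType R} (U : set V) x y (t : R) :
  @convex_set R V U -> U x -> U y -> 0 <= t -> t <= 1 ->
  U (t *: x + (1 - t) *: y).
Proof.
move=> cU /mem_set Ux /mem_set Uy t0 t1.
exact: (set_mem (cU _ _ (Itv01 t0 t1) Ux Uy)).
Qed.

(** The homothety of centre [x] and ratio [t] sends a ball about [p] in [U] to a ball in [U], of
    radius [t * r]. *)
Lemma convex_interior_segment {R : realType} {V : normedModType R} (U : set V)
    x p (t : R) : @convex_set R V U -> U x -> U° p -> 0 < t -> t <= 1 ->
  U° ((1 - t) *: x + t *: p).
Proof.
move=> cU Ux /nbhs_ballP[r /= r0 prU] t0 t1; apply/nbhs_ballP.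
exists (t * r) => /=; first by rewrite mulr_gt0.
move=> y; rewrite -ball_normE/= => yB.
have -> : y = t *: (t^-1 *: (y - (1 - t) *: x)) + (1 - t) *: x.
  by rewrite scalerA mulfV ?gt_eqF// scale1r subrK.
apply: convex_setP => //; last exact: ltW; apply: prU.
rewrite -ball_normE/= -(ltr_pM2l t0) -[X in X * `|_|](gtr0_norm t0) -normrZ.
rewrite scalerBr scalerA mulfV ?gt_eqF// scale1r opprB addrA.
by rewrite [t *: p + _]addrC.
Qed.

(** The extension is the infimum over [u] in [U] of the [L]-Lipschitz functions f u + L|x - u|; at a
    point of [U] it is attained at the point itself. *)
Lemma mcshane {R : realType} {V : normedModType R} (U : set V) (f : V -> R)
    (L : R) : U !=set0 -> 0 < L ->
  (forall x y, U x -> U y -> `|f x - f y| <= L * `|x - y|) ->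
  exists g : V -> R, (forall x y, `|g x - g y| <= L * `|x - y|) /\
    forall x, U x -> g x = f x.
Proof.
move=> [u0 Uu0] L0 fL; pose S x := [set f u + L * `|x - u| | u in U].
have Slb x : lbound (S x) (f u0 - L * `|x - u0|).
  move=> _ [u Uu <-].
  have := fL u0 u Uu0 Uu; have := ler_norm (f u0 - f u).
  have : L * `|u0 - u| <= L * (`|x - u0| + `|x - u|).
    by rewrite ler_wpM2l ?(ltW L0)// [`|x - u0|]distrC ler_distD.
  rewrite mulrDr; lra.
have hS x : has_lbound (S x) by exists (f u0 - L * `|x - u0|).
have S0 x : S x !=set0 by exists (f u0 + L * `|x - u0|), u0.
pose g x := inf (S x).
have gle x y : g x - L * `|x - y| <= g y.
  apply: lb_le_inf => // _ [u Uu <-].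
  have : g x <= f u + L * `|x - u| by apply: ge_inf => //; exists u.
  have : L * `|x - u| <= L * (`|x - y| + `|y - u|).
    by rewrite ler_wpM2l ?(ltW L0)// ler_distD.
  rewrite mulrDr; lra.
exists g; split.
  move=> x y; rewrite ler_norml; apply/andP; split.
    by have := gle y x; rewrite distrC; lra.
  by have := gle x y; lra.
move=> x Ux; apply/eqP; rewrite eq_le; apply/andP; split.
  by apply: ge_inf => //; exists x => //; rewrite subrr normr0 mulr0 addr0.
apply: lb_le_inf => // _ [u Uu <-].
by have := fL x u Ux Uu; have := ler_norm (f x - f u); lra.
Qed.

(** The linear map given by [M] is continuous, so uniqueness of the differential identifies it; the
    rows of the Jacobian are the images of the basis vectors. *)
Lemma is_jacobian {R : realType} {n : nat} (F : 'rV[R]_n -> 'rV[R]_n) u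
    (M : 'M[R]_n) :
  (forall e, 0 < e -> exists2 d, 0 < d &
     forall h, `|h| < d -> `|F (u + h) - F u - h *m M| <= e * `|h|) ->
  differentiable F u /\ 'J F u = M.
Proof.
move=> FM; pose df : {linear 'rV[R]_n -> 'rV[R]_n} := mulmxr M.
pose C := n%:R * `|M| + 1.
have C0 : 0 < C by rewrite ltr_wpDl// mulr_ge0.
have cdf : continuous df.
  apply: (@lipschitz_continuous _ _ _ _ C) => // x y.
  rewrite -linearB; move: (x - y) => {x y} h.
  apply: norm_rV_le => [|i]; first by rewrite mulr_ge0// ltW.
  rewrite mxE (le_trans (ler_norm_sum _ _ _))//.
  apply: (@le_trans _ _ (\sum_(j < n) `|M| * `|h|)).
    apply: ler_sum => j _; rewrite normrM mulrC ler_pM// ?le_coord_norm//.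
    by rewrite [leRHS]mx_normrE; apply: (le_bigmax _ _ (j, i)).
  rewrite sumr_const card_ord -[leLHS]mulr_natl mulrA ler_wpM2r//.
  by rewrite lerDl.
pose V : normedModType R := 'rV[R]_n.
have FE : (F : V -> V) \o shift (u : V) =
    cst (F u : V) + (df : V -> V) +o_ (0 : V) (@id V).
  apply/eqaddoP => e e0; have [d d0 hd] := FM _ e0.
  near=> h.
  have -> : ((F : V -> V) \o shift (u : V) -
      (cst (F u : V) + (df : V -> V))) h =
      F (u + h) - F u - h *m M.
    by rewrite -addrA -opprD [u + h]addrC.
  apply: hd.
  near: h; apply/nbhs_ballP; exists d => // h.
  by rewrite -ball_normE/= sub0r normrN.
have dE : 'd F u = df :> (_ -> _) by exact: diff_unique.
split; first by apply/diff_locallyP; rewrite dE.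
apply/row_matrixP => i; rewrite !rowE /jacobian mul_rV_lin1.
by rewrite [LHS](congr1 (fun g => g _) dE).
Unshelve. all: by end_near. Qed.

Lemma rademacher {R : realType} {n : nat} (k0 : 'I_n) (f : 'rV[R]_n -> R)
    (L : R) :
  0 < L -> (forall x y, `|f x - f y| <= L * `|x - y|) ->
  coord_null (~` [set x | exists b : 'rV[R]_n,
    forall e, 0 < e -> exists2 d, 0 < d & lin_approx f setT b e d x]).
Proof.
move=> L0 fL; apply: coord_nullS (approximable_setT L0 fL k0).
by apply: subsetC => x; exact: approximable_gradient.
Qed.

(** Off the union of the exceptional sets of the coordinates, the gradients form the columns of [M],
    and the least of the [n] scales serves for all coordinates. *)
Lemma rademacher_rV {R : realType} {n : nat} (k0 : 'I_n)
    (G : 'rV[R]_n -> 'rV[R]_n) (L : R) :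
  0 < L -> (forall x y, `|G x - G y| <= L * `|x - y|) ->
  coord_null (~` [set u | exists M : 'M[R]_n,
   forall e, 0 < e -> exists2 d, 0 < d &
     forall h, `|h| < d -> `|G (u + h) - G u - h *m M| <= e * `|h|]).
Proof.
move=> L0 GL.
have Gi i x y : `|G x 0 i - G y 0 i| <= L * `|x - y|.
  by have := le_coord_norm (G x - G y) i; rewrite !mxE => /le_trans; apply.
apply: coord_nullS (coord_null_bigcup k0 (fun i => rademacher k0 L0 (Gi i))).
move=> u; apply: contra_notP => uN.
have /choice[b hb] i : exists b : 'rV[R]_n, forall e, 0 < e ->
    exists2 d, 0 < d & lin_approx (fun x => G x 0 i) setT b e d u.
  by apply: contrapT => ub; apply: uN; exists i.
exists (\matrix_(j, i) b i 0 j) => e e0.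
have /choice[d hd] i : exists d,
    0 < d /\ lin_approx (fun x => G x 0 i) setT (b i) e d u.
  by have [d] := hb i _ e0; exists d.
pose dm := \big[Num.min/1]_i d i.
exists dm; first by apply/bigmin_gtP; split=> // i _; case: (hd i).
move=> h hdm; apply: norm_rV_le => [|i]; first by rewrite mulr_ge0// ltW.
have [_ /(_ h I)] := hd i.
have di : `|h| < d i by apply: (lt_le_trans hdm); exact: bigmin_le.
move=> /(_ di); rewrite !mxE; congr (`|_ - _| <= _).
by apply: eq_bigr => j _; rewrite mxE mulrC.
Qed.

(** The segment from [x] to [x + d] may consist of bad points, so it is shifted by a small [z] given
    by [coord_null_line]. The mean value inequality applies to [a G] along the shifted segment, and
    the cost of the shift is arbitrarily small. *)
Lemma increment_ge {R : realType} {n : nat} (k0 : 'I_n) (U : set 'rV[R]_n)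
    (F G : 'rV[R]_n -> 'rV[R]_n) (a d x : 'rV[R]_n) (L c : R) :
  @convex_set R 'rV[R]_n U -> 0 < L ->
  (forall x y, `|G x - G y| <= L * `|x - y|) -> (forall x, U x -> G x = F x) ->
  (forall u, U° u -> differentiable F u -> c <= dot a (d *m 'J F u)) ->
  U° x -> U° (x + d) -> c <= dot a (G (x + d) - G x).
Proof.
move=> cU L0 GL GF Fc /nbhs_ballP[e1 /= e1_gt0 xU].
move=> /nbhs_ballP[e2 /= e2_gt0 xdU].
pose eta := Num.min e1 e2.
have eta0 : 0 < eta by rewrite lt_min e1_gt0.
have seg z t : `|z| < eta -> 0 <= t -> t <= 1 -> U° (x + z + t *: d).
  move=> zeta t0 t1; apply/nbhs_ballP; exists (eta - `|z|) => /=.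
    by rewrite subr_gt0.
  move=> w; rewrite -ball_normE/= => wB.
  pose v := w - x - t *: d.
  have : `|v| < eta.
    rewrite (_ : v = z - (x + z + t *: d - w)); last first.
      by apply/rowP => i; rewrite !mxE; ring.
    by rewrite (le_lt_trans (ler_normB _ _))// -ltrBrDl.
  rewrite lt_min => /andP[v1 v2].
  (* A point near the shifted segment is a convex combination of points near [x] and near [x + d],
     both in [U]. *)
  rewrite (_ : w = t *: (x + d + v) + (1 - t) *: (x + v)); last first.
    by apply/rowP => i; rewrite !mxE; ring.
  by apply: convex_setP => //; [apply: xdU|apply: xU];
    rewrite -ball_normE/= opprD addNKr normrN.
pose K := n%:R * `|a|.
have K0 : 0 <= K by rewrite mulr_ge0.
have aK h : `|dot a h| <= K * `|h| by apply: dot_le => i; exact: le_coord_norm.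
apply/ler_addgt0Pr => e e0.
(* The first bound keeps the shifted segment in the interior of [U]; the second makes the total cost
   2KL zeta at most [e], the 1 ensuring a positive divisor. *)
pose zeta := Num.min (eta / 2) (e / (2 * (K * L) + 1)).
have KL0 : 0 <= K * L by rewrite mulr_ge0// ltW.
have zeta0 : 0 < zeta.
  by rewrite lt_min !divr_gt0// ltr_wpDl// mulr_ge0.
have [z [zz [N [mN N0 zN]]]] :=
  coord_null_line x d zeta0 (rademacher_rV k0 L0 GL).
have zeta_lt : `|z| < eta.
  rewrite (le_lt_trans zz)// gt_min; apply/orP; left.
  by rewrite ltr_pdivrMr// ltr_pMr// ltr1n.
pose h t := dot a (G (x + z + t *: d)).
have hL s t : `|h s - h t| <= (K * L * `|d| + 1) * `|s - t|.
  rewrite /h -[_ - _]dotBr (le_trans (aK _))//.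
  rewrite (le_trans (ler_wpM2l K0 (GL _ _)))// opprD addrACA subrr add0r.
  rewrite -scalerBl normrZ mulrDl mul1r.
  by rewrite [`|s - t| * _]mulrC !mulrA lerDl.
have hL0 : 0 < K * L * `|d| + 1 by rewrite ltr_wpDl// mulr_ge0.
have : c * (1 - 0) <= h 1 - h 0.
  apply: (lipschitz_mean_value hL0 hL) => //.
  exists N; split=> // t nt; apply: zN => /=.
  apply: contra_not nt => -[M hM] /andP[t0 t1].
  set u := x + z + t *: d in hM *.
  have Uu : U° u by apply: seg => //; exact: ltW.
  have /nbhs_ballP[r /= r0 urU] := Uu.
  (* [F] and [G] agree on a neighbourhood of the interior point [u], so [F] inherits the expansion
     of [G]. *)
  have FM e' : 0 < e' -> exists2 d, 0 < d &
      forall h, `|h| < d -> `|F (u + h) - F u - h *m M| <= e' * `|h|.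
    move=> /hM[d' d'0 hd']; exists (Num.min r d'); first by rewrite lt_min r0.
    move=> y; rewrite lt_min => /andP[yr yd'].
    rewrite -!GF; first exact: hd'.
      by apply: urU; exact: ballxx.
    by apply: urU; rewrite -ball_normE/= opprD addNKr normrN.
  have [dF JF] := is_jacobian FM.
  exists (dot a (d *m M)); first by rewrite -JF; exact: Fc.
  move=> e' e'0.
  pose C := K * `|d| + 1.
  have C0 : 0 < C by rewrite ltr_wpDl// mulr_ge0.
  have [d1 d10 hd1] := hM _ (divr_gt0 e'0 C0).
  exists (d1 / (`|d| + 1)); first by rewrite divr_gt0// ltr_wpDl.
  move=> s sd1; rewrite /h -/u.
  have sd : `|s *: d| < d1.
    rewrite normrZ (@le_lt_trans _ _ (`|s| * (`|d| + 1)))//.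
      by rewrite ler_wpM2l// lerDl.
    by rewrite -ltr_pdivlMr// ltr_wpDl.
  have := hd1 _ sd; rewrite -scalemxAl => H.
  rewrite scalerDl addrA -/u -dotZr -!dotBr.
  rewrite (le_trans (aK _))// (le_trans (ler_wpM2l K0 H))//.
  rewrite normrZ (_ : K * _ = (e' * `|s|) * ((K * `|d|) / C)); last first.
    by field; rewrite gt_eqF.
  rewrite ler_piMr ?mulr_ge0 ?(ltW e'0)// ler_pdivrMr// mul1r.
  by rewrite lerDl.
rewrite subr0 mulr1 /h scale1r scale0r addr0 -dotBr => /le_trans; apply.
(* Cost of moving the two endpoints back by [z]. *)
have B1 : `|dot a (G (x + z + d) - G (x + d))| <= K * (L * zeta).
  rewrite (le_trans (aK _))// ler_wpM2l// (le_trans (GL _ _))//.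
  rewrite ler_wpM2l ?(ltW L0)//.
  by rewrite (_ : _ - _ = z)//; apply/rowP => i; rewrite !mxE; ring.
have B2 : `|dot a (G (x + z) - G x)| <= K * (L * zeta).
  rewrite (le_trans (aK _))// ler_wpM2l// (le_trans (GL _ _))//.
  rewrite ler_wpM2l ?(ltW L0)//.
  by rewrite addrAC subrr add0r.
have : 2 * (K * (L * zeta)) <= e.
  have : zeta <= e / (2 * (K * L) + 1) by rewrite ge_min lexx orbT.
  have KL1 : 0 < 2 * (K * L) + 1 by rewrite ltr_wpDl// mulr_ge0.
  rewrite ler_pdivlMr// mulrDr mulr1; apply: le_trans.
  by rewrite (_ : zeta * _ = 2 * (K * (L * zeta))) ?lerDl ?(ltW zeta0)//; ring.
rewrite !dotBr in B1 B2 *.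
move: B1 B2 => /ler_normlP[_ B1] /ler_normlP[B2 _]; lra.
Qed.

(** * Comparison of the Euclidean and sup norms *)

Section euclidean_norm.
Context {R : realType} {n : nat}.
Implicit Types x : 'rV[R]_n.

Lemma norm_le_enorm x : `|x| <= enorm x.
Proof.
apply: norm_rV_le => [|i]; first exact: sqrtr_ge0.
rewrite -sqrtr_sqr ler_wsqrtr// (bigD1 i)//= lerDl sumr_ge0// => j _.
exact: sqr_ge0.
Qed.

Lemma enorm_le_norm x : enorm x <= Num.sqrt n%:R * `|x|.
Proof.
rewrite -[`|x|]ger0_norm// -sqrtr_sqr -sqrtrM// ler_wsqrtr//.
apply: (@le_trans _ _ (\sum_(i < n) `|x| ^+ 2)).
  apply: ler_sum => i _; rewrite -[leLHS]real_normK ?num_real//.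
  by rewrite ler_pXn2r ?nnegrE// le_coord_norm.
by rewrite sumr_const card_ord -[leLHS]mulr_natl.
Qed.

Lemma enorm0 : enorm (0 : 'rV[R]_n) = 0.
Proof. by rewrite /enorm big1 ?sqrtr0// => i _; rewrite mxE expr0n. Qed.

Lemma enorm_sign (b : bool) x : enorm ((-1) ^+ b *: x) = enorm x.
Proof.
by congr Num.sqrt; apply: eq_bigr => i _; rewrite mxE exprMn sqrr_sign mul1r.
Qed.

End euclidean_norm.

Lemma lipschitz_extension {R : realType} {n : nat} (U : set 'rV[R]_n)
    (F : 'rV[R]_n -> 'rV[R]_n) : U !=set0 -> lipschitz_map U F ->
  exists (L : R) (G : 'rV[R]_n -> 'rV[R]_n),
  [/\ 0 < L, forall x y, `|G x - G y| <= L * `|x - y| &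
      forall x, U x -> G x = F x].
Proof.
(* The factor sqrt n converts the Euclidean bound to the sup norm; the absolute value and the 1 make
   the constant positive whatever the sign of [L]. *)
move=> U0 [L FL]; pose L' := `|L| * Num.sqrt n%:R + 1.
have L'0 : 0 < L' by rewrite ltr_wpDl// mulr_ge0// sqrtr_ge0.
have Fi i x y : U x -> U y -> `|F x 0 i - F y 0 i| <= L' * `|x - y|.
  move=> Ux Uy; have := le_coord_norm (F x - F y) i.
  rewrite !mxE => /le_trans; apply.
  rewrite (le_trans (norm_le_enorm _))// (le_trans (FL _ _ Ux Uy))//.
  apply: (@le_trans _ _ (`|L| * enorm (x - y))).
    by rewrite ler_wpM2r ?sqrtr_ge0// ler_norm.
  rewrite mulrDl -mulrA ler_wpDr ?mulr_ge0// ler_wpM2l//.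
  exact: enorm_le_norm.
have /choice[g hg] i := mcshane U0 L'0 (Fi i).
exists L', (fun x => \row_i g i x); split => // [x y|x Ux].
  apply: norm_rV_le => [|i]; first by rewrite mulr_ge0// ltW.
  by rewrite !mxE; case: (hg i).
by apply/rowP => i; rewrite mxE (hg i).2.
Qed.

(** The constant sequence at [u] is admissible. *)
Lemma clarke_jacobian_differentiable {R : realType} {n : nat} (U : set 'rV[R]_n)
    (F : 'rV[R]_n -> 'rV[R]_n) u : U° u -> differentiable F u ->
  clarke_jacobian U F u (usual_jacobian F u).
Proof.
move=> Uu dF B [_ +]; apply; exists (fun=> u); split => //; exact: cvg_cst.
Qed.

(* With the signs of [d] chosen as the signs of the cones, the columns of [J]
   contribute to [J d] with nonnegative weights [|d_i|]. *)
Lemma strict_V_family_certificate {R : realType} {n : nat} (MM : set 'M[R]_n)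
    (d : 'rV[R]_n) : strict_V_family MM -> d != 0 ->
  (forall i : 'I_n, i = 0%N :> nat -> 0 <= d 0 i) ->
  exists (a : 'rV[R]_n) (c : R), 0 < c /\
    forall M, MM M^T -> c <= dot a (d *m M).
Proof.
move=> [[[delta delta0 Rdelta] _] cert] d0 dsign.
(* Since the first coordinate of [d] is nonnegative, this choice puts a plus sign on the first
   cone. *)
pose s := [ffun i => d 0 i < 0].
have [|a [eps [eps0 sa]]] := cert s.
  by move=> i i0; rewrite ffunE ltNge dsign.
(* Row [i] of [M], of Euclidean norm above [delta], contributes at least [eps * delta] with weight
   |d_i|. *)
exists a, (eps * delta * \sum_(i < n) `|d 0 i|); split.
  rewrite !mulr_gt0// lt_neqAle sumr_ge0// andbT eq_sym.
  apply: contra d0; rewrite psumr_eq0// => /allP dall.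
  apply/eqP/rowP => i; rewrite mxE; apply/eqP.
  by rewrite -normr_eq0; apply: (implyP (dall i _)) => //;
    rewrite mem_index_enum.
move=> M MM_M.
(* The library's Jacobian is the transpose of the usual one, so the columns of the family appear as
   rows of [M]. *)
have rowM j : column_set MM j (row j M).
  by exists M^T => //; rewrite tr_col trmxK.
have rowM_gt j : delta < enorm (row j M).
  rewrite ltNge; apply/negP => le; have : set0 (row j M) by rewrite -(Rdelta j).
  by [].
have cone j : column_cone MM j (row j M) /\ column_cone MM j 0.
  have hj : row j M != 0 /\ ray (row j M) `&` column_set MM j !=set0.
    split.
      apply/eqP => r0; have := rowM_gt j.
      by rewrite r0 enorm0 ltNge (ltW delta0).
    by exists (row j M); split=> //; exists 1 => //; rewrite scale1r.
  split; exists (row j M) => //; first by exists 1 => //; rewrite scale1r.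
  by exists 0 => //; rewrite scale0r.
rewrite mulmx_sum_row (big_morph (dot a) (dotDr a) (_ : dot a 0 = 0)).
  2: by rewrite /dot big1// => i _; rewrite mxE mulr0.
rewrite mulr_sumr; apply: ler_sum => i _.
(* As 0 lies in every column cone, a single signed row already belongs to the signed sum, and the
   certificate applies to each row separately. *)
have /sa /= H : signed_sum (column_cone MM) s ((-1) ^+ s i *: row i M).
  exists (fun j => if j == i then row i M else 0).
    by move=> j; case: eqVneq => [->|_]; [exact: (cone i).1|exact: (cone j).2].
  rewrite (bigD1 i)//= eqxx big1 ?addr0// => j ji.
  by rewrite (negbTE ji) scaler0.
rewrite enorm_sign in H.
have -> : d 0 i *: row i M = `|d 0 i| *: ((-1) ^+ s i *: row i M).
  by rewrite scalerA mulrC ffunE -realEsign ?num_real.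
rewrite dotZr mulrC ler_wpM2l//; apply: le_trans H.
by rewrite ler_wpM2l ?(ltW eps0)// ltW.
Qed.

(** * Injectivity *)

(** As [x] and [y] may be boundary points, both are moved by a fraction [t] towards an interior
    point [p]. Then [a G] grows by at least (1 - t) c between the moved points, whereas F x = F y
    bounds this growth by t B; a small [t] gives a contradiction. *)
Lemma no_collision {R : realType} {n : nat} (U : set 'rV[R]_n)
    (F : 'rV[R]_n -> 'rV[R]_n) x y :
  convex_domain U -> lipschitz_map U F ->
  strict_V_family (\bigcup_(u in U) clarke_jacobian U F u) ->
  U x -> U y -> x != y -> (forall i : 'I_n, i = 0%N :> nat -> x 0 i <= y 0 i) ->
  F x != F y.
Proof.
move=> [cU [p Up]] FL Fstrict Ux Uy xy xy0; apply/eqP => Fxy.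
pose d := y - x.
have d0 : d != 0 by rewrite subr_eq0 eq_sym.
have dsign (i : 'I_n) : i = 0%N :> nat -> 0 <= d 0 i.
  by move=> i0; rewrite !mxE subr_ge0 xy0.
(* A nonzero [d] shows that the dimension is positive, as the results on exceptional sets
   require. *)
have [k0 _] : exists k : 'I_n, d 0 k != 0 by exact/rV0Pn.
have [a [c [c0 ac]]] := strict_V_family_certificate Fstrict d0 dsign.
have [|L [G [L0 GL GF]]] := lipschitz_extension _ FL; first by exists x.
pose K := n%:R * `|a|.
have K0 : 0 <= K by rewrite mulr_ge0.
have aK h : `|dot a h| <= K * `|h| by apply: dot_le => i; exact: le_coord_norm.
pose B := K * (L * (`|p - y| + `|x - p|)).
have B0 : 0 <= B by rewrite !mulr_ge0 ?addr_ge0// ltW.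
have key t : 0 < t -> t < 1 -> (1 - t) * c <= t * B.
  move=> t0 t1; have t1' := ltW t1.
  pose xt := (1 - t) *: x + t *: p; pose yt := (1 - t) *: y + t *: p.
  have ytE : yt = xt + (1 - t) *: d by apply/rowP => i; rewrite !mxE; ring.
  have Uxt : U° xt by exact: convex_interior_segment.
  have Uyt : U° yt by exact: convex_interior_segment.
  have : (1 - t) * c <= dot a (G (xt + (1 - t) *: d) - G xt).
    apply: (@increment_ge _ _ k0 U F G a ((1 - t) *: d) xt L ((1 - t) * c)
      cU L0 GL GF _ Uxt); last by rewrite -ytE.
    move=> u Uu dF; rewrite -scalemxAl dotZr ler_wpM2l ?subr_ge0//.
    apply: ac; exists u; first exact: interior_subset.
    exact: clarke_jacobian_differentiable.
  move=> /le_trans; apply; rewrite -ytE.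
  rewrite (_ : G yt - G xt = (G yt - G y) + (G x - G xt)); last first.
    by rewrite (GF _ Ux) (GF _ Uy) Fxy addrA subrK.
  rewrite dotDr (le_trans (lerD (ler_norm _) (ler_norm _)))//.
  rewrite (le_trans (lerD (aK _) (aK _)))// -mulrDr.
  rewrite (_ : t * B = K * (L * (t * `|p - y|) + L * (t * `|x - p|))).
    2: by rewrite /B; ring.
  rewrite ler_wpM2l// lerD// (le_trans (GL _ _))// ler_wpM2l ?(ltW L0)//.
    rewrite (_ : yt - y = t *: (p - y)) ?normrZ ?gtr0_norm//.
    by apply/rowP => i; rewrite !mxE; ring.
  rewrite (_ : x - xt = t *: (x - p)) ?normrZ ?gtr0_norm//.
  by apply/rowP => i; rewrite !mxE; ring.
have Bc0 : 0 < B + c by rewrite ltr_wpDl.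
(* With this choice t (B + c) = c / 2, whereas [key] requires c <= t (B + c). *)
pose t := c / (2 * (B + c)).
have t0 : 0 < t by rewrite divr_gt0// mulr_gt0.
have tE : t * (B + c) = c / 2 by rewrite /t; field; rewrite gt_eqF.
have t1 : t < 1.
  rewrite ltr_pdivrMr ?mulr_gt0// mul1r; lra.
have := key t t0 t1; lra.
Qed.

Theorem theorem1 (R : realType) (n : nat)
    (U : set 'rV[R]_n) (F : 'rV[R]_n -> 'rV[R]_n)
    (U_convex_domain : convex_domain U)
    (F_lipschitz : lipschitz_map U F)
    (F_strict : strict_V_family (\bigcup_(u in U) clarke_jacobian U F u)) :
  {in U &, injective F}.
Proof.
move=> x y; rewrite !inE => Ux Uy Fxy; apply/eqP/contraT => xy.
(* The first cone carries a plus sign, so the points are ordered by their first coordinate,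
   exchanging them if necessary. *)
have [xy0|] := pselect (forall i : 'I_n, i = 0%N :> nat -> x 0 i <= y 0 i).
  have := no_collision U_convex_domain F_lipschitz F_strict Ux Uy xy xy0.
  by rewrite Fxy eqxx.
move=> /existsNP[i /not_implyP[i0 /negP]]; rewrite -ltNge => /ltW yx.
rewrite eq_sym in xy.
have := no_collision U_convex_domain F_lipschitz F_strict Uy Ux xy.
rewrite Fxy eqxx; apply => j j0.
by rewrite (_ : j = i)//; apply/val_inj; rewrite /= j0.
Qed.
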